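(* For $r,s\in\mathbb N$ and $m=\max(r,s)\geq1$, consider the $m$-orthogonal polynomials $$P_n(x)=\frac{(-1)^n(a_1)_n\cdots(a_r)_n}{\left(b_1^{(n-1)}\right)_n\cdots\left(b_s^{(n-1)}\right)_n}\;{}_{s+1}F_r\left(\left.\begin{matrix}-n,b_1^{(n-1)},\dots,b_s^{(n-1)}\\ a_1,\dots,a_r\end{matrix}\,\right|\,x\right),$$ where $b_j^{(n-1)}=b_j+\left\lceil\frac{n-\lambda_j}{r}\right\rceil$ with $1\leq\lambda_1<\cdots<\lambda_s\leq r$ when $r\geq s$, or $b_j^{(n-1)}=b_j+\left\lceil\frac{n-j}{s}\right\rceil$ when $r\leq s$; denote $P_n(x)$ by $P_n^{[(r,s),(\lambda_1,\dots,\lambda_s)]}\left(x\left|\begin{matrix}a_1,\dots,a_r\\ b_1,\dots,b_s\end{matrix}\right.\right)$ when $r\geq s$ and by $P_n^{[(r,s)]}\left(x\left|\begin{matrix}a_1,\dots,a_r\\ b_1,\dots,b_s\end{matrix}\right.\right)$ when $r\leq s$. Then, for $n\ge1$, when $r\geq s$, we have $$\frac{\mathrm d}{\mathrm dx}P_n^{[(r,s),(\lambda_1,\dots,\lambda_s)]}\left(x\left|\begin{matrix}a_1,\dots,a_r\\ b_1,\dots,b_s\end{matrix}\right.\right)=\begin{cases}n\,P_{n-1}^{[(r,s),(\lambda_2-1,\dots,\lambda_s-1,r)]}\left(x\left|\begin{matrix}a_1+1,\dots,a_r+1\\ b_2+1,\dots,b_s+1,b_1+2\end{matrix}\right.\right)&\text{if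 }\lambda_1=1,\\[3mm] n\,P_{n-1}^{[(r,s),(\lambda_1-1,\dots,\lambda_s-1)]}\left(x\left|\begin{matrix}a_1+1,\dots,a_r+1\\ b_1+1,\dots,b_s+1\end{matrix}\right.\right)&\text{if }\lambda_1\geq2\ (\text{or }s=0),\end{cases}$$ and, when $r\leq s$, $$\frac{\mathrm d}{\mathrm dx}P_n^{[(r,s)]}\left(x\left|\begin{matrix}a_1,\dots,a_r\\ b_1,\dots,b_s\end{matrix}\right.\right)=n\,P_{n-1}^{[(r,s)]}\left(x\left|\begin{matrix}a_1+1,\dots,a_r+1\\ b_2+1,\dots,b_s+1,b_1+2\end{matrix}\right.\right).$$
   Context: $\mathbb N=\{0,1,2,\dots\}$; $(z)_0=1$, $(z)_n=z(z+1)\cdots(z+n-1)$ for $n\ge1$; ${}_pF_q\left(\left.\begin{matrix}c_1,\dots,c_p\\ d_1,\dots,d_q\end{matrix}\,\right|\,x\right)=\sum_{n\ge0}\frac{(c_1)_n\cdots(c_p)_n}{(d_1)_n\cdots(d_q)_n}\frac{x^n}{n!}$ (here terminating). The parameters $a_i,b_j$ are indeterminates and the polynomials have coefficients in $\mathbb Q(b_1,\dots,b_s)[a_1,\dots,a_r]$. In the notation $P^{[(r,s),(\lambda_1,\dots,\lambda_s)]}$ the $j$-th parameter in the lower row is the one attached to $\lambda_j$; in $P^{[(r,s)]}$ the $j$-th parameter in the lower row is shifted by $\lceil (n-j)/s\rceil$. *)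

(* Defs.v *)
From HB Require Import structures.
From mathcomp Require Import all_boot all_order all_algebra.
From mathcomp Require Import mpoly.

Set Implicit Arguments.
Unset Strict Implicit.
Unset Printing Implicit Defensive.

Import Order.TTheory GRing.Theory Num.Theory.
Local Open Scope ring_scope.

Section Hypergeometric.

Variable F : fieldType.
Implicit Types (z : F) (a b c d : seq F).

Definition poch z (k : nat) : F := \prod_(i < k) (z + i%:R).

Definition pFq_coef c d (k : nat) : F :=
  (\prod_(z <- c) poch z k) / (\prod_(z <- d) poch z k) / k`!%:R.

(* The terminating series with upper row (-n, c): the omitted terms, those of
   degree k > n, vanish by [pFq_coef_terminating]. *)
Definition pFq_terminating (n : nat) c d : {poly F} :=
  \poly_(k < n.+1) pFq_coef (- n%:R :: c) d k.

Lemma pFq_coef_terminating (n : nat) c d (k : nat) :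
  (n < k)%N -> pFq_coef (- n%:R :: c) d k = 0.
Proof.
move=> ltnk; rewrite /pFq_coef big_cons /poch.
by rewrite (bigD1 (Ordinal ltnk)) //= addNr !mul0r.
Qed.

(* [b] is the row of the b_j^(n-1), i.e. it is already shifted. *)
Definition hyp_poly (n : nat) a b : {poly F} :=
  ((-1) ^+ n * (\prod_(z <- a) poch z n) / (\prod_(z <- b) poch z n))
    *: pFq_terminating n b a.

(* The row b_j + ceil((n - lam_j) / q); the quotient is taken in rat, so that
   the ceiling may be negative. *)
Definition shift_row (q : nat) (lam : seq nat) (n : nat) b : seq F :=
  [seq p.1 + (Num.ceil ((n%:R - p.2%:R) / q%:R : rat))%:~R | p <- zip b lam].

(* P_n^[(r,s),lam] and P_n^[(r,s)], with r = size a and s = size b. *)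
Definition P_ge (lam : seq nat) (n : nat) a b : {poly F} :=
  hyp_poly n a (shift_row (size a) lam n b).

Definition P_le (n : nat) a b : {poly F} :=
  hyp_poly n a (shift_row (size b) (iota 1 (size b)) n b).

End Hypergeometric.

(* Q(b_1,...,b_s), and the fraction field of Q(b_1,...,b_s)[a_1,...,a_r], in
   which the quotients (a_i)_n / (a_i)_k are formed. *)
Definition Qb (s : nat) : fieldType := {fraction {mpoly rat[s]}}.
Definition Qba (r s : nat) : fieldType := {fraction {mpoly (Qb s)[r]}}.

Definition indet_a (r s : nat) : seq (Qba r s) :=
  [seq tofrac ('X_i : {mpoly (Qb s)[r]}) | i <- enum 'I_r].

Definition indet_b (r s : nat) : seq (Qba r s) :=
  [seq tofrac ((tofrac ('X_j : {mpoly rat[s]}) : Qb s)%:MP_[r] : {mpoly (Qb s)[r]})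
    | j <- enum 'I_s].

(* Main.v *)
(** Differentiating the series termwise, [(z)_(k+1) = z (z+1)_k] shows that
    the derivative of the degree [n] polynomial is [n] times the degree [n-1]
    polynomial with all parameters, including the already shifted ones
    [b_j^(n-1)], raised by one.  The raised row is then the shifted row of the
    right-hand side up to order, because
    [ceil ((n - 1 - (l - 1)) / q) = ceil ((n - l) / q)] and, for the index
    [l = 1] that is recycled into [q],
    [2 + ceil ((n - 1 - q) / q) = 1 + ceil ((n - 1) / q)]. *)

Require Import Defs.
From HB Require Import structures.
From mathcomp Require Import all_boot all_order all_algebra.
From mathcomp Require Import mpoly ring.

Set Implicit Arguments.
Unset Strict Implicit.
Unset Printing Implicit Defensive.

Import Order.TTheory GRing.Theory Num.Theory.
Local Open Scope ring_scope.

Section HypergeometricDerivative.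

Variable F : fieldType.
Implicit Types (z : F) (a b : seq F).

Lemma pochS z k : poch z k.+1 = z * poch (z + 1) k.
Proof.
rewrite /poch big_ord_recl addr0; congr (_ * _).
by apply: eq_bigr => i _; rewrite /= /bump add1n -addrA nat1r.
Qed.

Lemma prod_pochS a k :
  \prod_(z <- a) poch z k.+1 =
  (\prod_(z <- a) z) * \prod_(z <- [seq z + 1 | z <- a]) poch z k.
Proof.
rewrite big_map -big_split.
by apply: eq_bigr => z _; rewrite pochS.
Qed.

(** [b] enters only through products over its entries, so the recycled parameter may change
    position. *)
Lemma perm_hyp_poly n a b b' :
  perm_eq b b' -> hyp_poly n a b = hyp_poly n a b'.
Proof.
move=> pb; rewrite /hyp_poly (perm_big _ pb); congr (_ *: _).
apply/polyP => k; rewrite !coef_poly /pFq_coef !big_cons.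
by rewrite (perm_big _ pb).
Qed.

(** The products of [a] and of [b] split off by [prod_pochS] each occur once in the prefactor and
    once inverted in the series (or conversely), so they cancel. The leading factor of the
    Pochhammer symbol of [- n.+1%:R] supplies both [n.+1] and the missing sign. *)
Lemma deriv_hyp_poly n a b :
  (forall k, k.+1%:R != 0 :> F) -> 0 \notin a -> 0 \notin b ->
  (hyp_poly n.+1 a b)^`() =
    n.+1%:R *: hyp_poly n [seq z + 1 | z <- a] [seq z + 1 | z <- b].
Proof.
have prod_neq0 (s : seq F) : 0 \notin s -> \prod_(z <- s) z != 0.
  by move=> s0; rewrite prodf_seq_neq0; apply/allP => z zs /=;
     apply: contraNneq s0 => <-.
move=> char0 /prod_neq0 a0 /prod_neq0 b0; apply/polyP => k.
rewrite coef_deriv !coefZ !coef_poly ltnS.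
case: ltnP => _; last by rewrite !mulr0 mul0rn.
rewrite /pFq_coef !big_cons !prod_pochS pochS.
have -> : - n.+1%:R + 1 = - n%:R :> F by rewrite -natr1 opprD addrNK.
rewrite factS natrM -[LHS]mulr_natr exprS !invfM.
move: (\prod_(z <- a) z) (\prod_(z <- b) z) a0 b0 => A B a0 b0.
move: (char0 k) (n.+1%:R : F); move: (k.+1%:R : F) => K K0 N.
(* These inverses are the same on both sides; as atoms they spare [field] any nonvanishing condition
   beyond those on [A], [B] and [K]. *)
move: (k`!%:R^-1) (poch _ k) => X Y.
move: (\prod_(z <- _) poch z n)^-1 (\prod_(z <- _) poch z k)^-1 => A' B'.
by field; rewrite a0 b0 K0.
Qed.

Lemma ceil_shift_pred (q n l : nat) : (0 < l)%N ->
  Num.ceil ((n%:R - l.-1%:R) / q%:R : rat) =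
  Num.ceil ((n.+1%:R - l%:R) / q%:R : rat).
Proof.
case: l => // l _.
by rewrite -[n.+1%:R]natr1 -[l.+1%:R]natr1 opprD addrACA subrr addr0.
Qed.

Lemma ceil_shift_wrap (q n : nat) : (0 < q)%N ->
  Num.ceil ((n%:R - q%:R) / q%:R : rat) =
  Num.ceil ((n.+1%:R - 1%:R) / q%:R : rat) - 1.
Proof.
move=> q0; rewrite -[n.+1%:R]natr1 addrK mulrBl divff ?pnatr_eq0 -?lt0n //.
by rewrite ceilDrz ?rpredN1 // ceilN ?rpred1 // ceil1.
Qed.

Lemma shift_row_pred (q n : nat) (lam : seq nat) b :
  all (leq 1) lam ->
  shift_row q [seq l.-1 | l <- lam] n [seq z + 1 | z <- b] =
  [seq z + 1 | z <- shift_row q lam n.+1 b].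
Proof.
rewrite /shift_row; elim: lam b => [|l lam IH] [|z b] //= /andP[l0 lam0].
by rewrite ceil_shift_pred // addrAC -IH.
Qed.

Lemma shift_row_cycle (q n : nat) (lam : seq nat) z b :
  (0 < q)%N -> all (leq 1) lam -> size b = size lam ->
  perm_eq [seq x + 1 | x <- shift_row q (1%N :: lam) n.+1 (z :: b)]
    (shift_row q (rcons [seq l.-1 | l <- lam] q) n
       (rcons [seq x + 1 | x <- b] (z + 2))).
Proof.
move=> q0 lam0 sz; rewrite {2}/shift_row zip_rcons ?size_map // map_rcons.
rewrite -/(shift_row q [seq l.-1 | l <- lam] n _) shift_row_pred //=.
(* Bring the recycled entry back to the front, where it faces the head of the raised row. *)
rewrite perm_sym perm_rcons /= ceil_shift_wrap // rmorphB /=.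
have -> : z + 2 + ((Num.ceil ((n.+1%:R - 1%:R) / q%:R : rat))%:~R - 1) =
          z + (Num.ceil ((n.+1%:R - 1%:R) / q%:R : rat))%:~R + 1 by ring.
by [].
Qed.

Lemma shift_row_neq0 (q n : nat) (lam : seq nat) b :
  (forall z (k : int), z \in b -> z + k%:~R != 0) ->
  0 \notin shift_row q lam n b.
Proof.
move=> b0; apply/mapP => -[[z l] zl] /esym/eqP; apply/negP/b0.
(* It remains to see that the first component of a member of the zip lies in [b]. *)
elim: b lam zl {b0} => [|y b IH] [|k lam] //=.
by rewrite !inE => /orP[/eqP[-> _]|/IH->]; rewrite ?eqxx ?orbT.
Qed.

End HypergeometricDerivative.

(** The coefficient at [U_(i)] is 1, as the integer only affects the constant term. *)
Lemma mpolyX_addz_neq0 (R : comNzRingType) (k : nat) (i : 'I_k) (c : int) :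
  'X_i + c%:~R != 0 :> {mpoly R[k]}.
Proof.
apply/eqP => /(congr1 (mcoeff U_(i))); rewrite mcoeff0 mcoeffD mcoeffX eqxx.
rewrite -(rmorph_int (@mpolyC k R)) mcoeffC mnm1_eq0 mulr0 addr0.
by move/eqP; rewrite oner_eq0.
Qed.

Section Indeterminates.

Variables r s : nat.

(** Pull the integer back to [rat] through the four injections that build [Qba]. *)
Lemma Qba_natr_neq0 k : k.+1%:R != 0 :> Qba r s.
Proof.
rewrite -(rmorph_nat (@tofrac {mpoly (Qb s)[r]})) tofrac_eq0.
rewrite -(rmorph_nat (@mpolyC r (Qb s))) mpolyC_eq0.
rewrite -(rmorph_nat (@tofrac {mpoly rat[s]})) tofrac_eq0.
by rewrite -(rmorph_nat (@mpolyC s rat)) mpolyC_eq0 pnatr_eq0.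
Qed.

Lemma indet_a_neq0 : 0 \notin indet_a r s.
Proof.
apply/mapP => -[i _ /esym/eqP]; rewrite tofrac_eq0.
by rewrite -['X_i]addr0 -[0]/(0%:~R) (negPf (mpolyX_addz_neq0 _ _ 0)).
Qed.

Lemma indet_b_addz_neq0 (z : Qba r s) (k : int) :
  z \in indet_b r s -> z + k%:~R != 0.
Proof.
case/mapP => j _ ->.
rewrite -(rmorph_int (@tofrac {mpoly (Qb s)[r]})) -rmorphD tofrac_eq0.
rewrite -(rmorph_int (@mpolyC r (Qb s))) -rmorphD mpolyC_eq0.
rewrite -(rmorph_int (@tofrac {mpoly rat[s]})) -rmorphD tofrac_eq0.
exact: mpolyX_addz_neq0.
Qed.

Lemma size_indet_a : size (indet_a r s) = r.
Proof. by rewrite size_map size_enum_ord. Qed.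

Lemma size_indet_b : size (indet_b r s) = s.
Proof. by rewrite size_map size_enum_ord. Qed.

End Indeterminates.

Theorem proposition6p5 (r s : nat) (hm : (1 <= maxn r s)%N) (n : nat)
    (hn : (1 <= n)%N) :
  let a := indet_a r s in
  let b := indet_b r s in
  let a_up := [seq z + 1 | z <- a] in
  let b_up := [seq z + 1 | z <- b] in
  let b_cyc := rcons [seq z + 1 | z <- behead b] (head 0 b + 2) in
  ((s <= r)%N ->
     forall lam : s.-tuple nat,
       sorted ltn lam -> (forall l, l \in lam -> (1 <= l <= r)%N) ->
       (nth 0%N lam 0 = 1%N ->
          (P_ge lam n a b)^`() =
            n%:R *: P_ge (rcons [seq l.-1 | l <- behead lam] r) n.-1 a_up b_cyc)
       /\
       ((2 <= nth 0%N lam 0)%N \/ s = 0%N ->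
          (P_ge lam n a b)^`() =
            n%:R *: P_ge [seq l.-1 | l <- lam] n.-1 a_up b_up))
  /\
  ((r <= s)%N ->
     (P_le n a b)^`() = n%:R *: P_le n.-1 a_up b_cyc).
Proof.
case: n hn => // n _ a b a_up b_up b_cyc; rewrite [n.+1.-1]/=.
have sza : size a = r := size_indet_a r s.
have szb : size b = s := size_indet_b r s.
have szup : size a_up = r by rewrite size_map.
have derivP q (lam : seq nat) :
    (hyp_poly n.+1 a (shift_row q lam n.+1 b))^`() =
    n.+1%:R *: hyp_poly n a_up [seq z + 1 | z <- shift_row q lam n.+1 b].
  apply: deriv_hyp_poly; [exact: Qba_natr_neq0 | exact: indet_a_neq0 |].
  by apply: shift_row_neq0 => z k; apply: indet_b_addz_neq0.
(* Shared by both recycling cases: [q] will be [r] when the first index is 1, and [s] when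
   [r <= s]. *)
have cycP q (lam : seq nat) : (0 < q)%N -> all (leq 1) lam ->
    size b = (size lam).+1 ->
    (hyp_poly n.+1 a (shift_row q (1%N :: lam) n.+1 b))^`() =
    n.+1%:R *: hyp_poly n a_up
      (shift_row q (rcons [seq l.-1 | l <- lam] q) n b_cyc).
  move=> q0 lam0 szlam; rewrite derivP; congr (_ *: _).
  apply: perm_hyp_poly; rewrite /b_cyc.
  (* The size condition makes [b] nonempty, so the default value of [head] never occurs. *)
  case: (b) szlam => // z b' [szlam].
  exact: shift_row_cycle.
split=> [sr lam _ lamP | rs].
  have lam0 : all (leq 1) lam by apply/allP => l /lamP /andP[].
  rewrite /P_ge sza szup; split=> [lam1 | _].
    have := size_tuple lam; case: (tval lam) lam0 lam1 => //= l lam' + l1.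
    rewrite {}l1 => /andP[_ lam0] szlam.
    by rewrite cycP ?szb //; apply: leq_trans sr; rewrite -szlam.
  by rewrite derivP -shift_row_pred.
have s0 : (0 < s)%N by move: hm; rewrite (maxn_idPr rs).
rewrite /P_le {hm}.
have -> : size b_cyc = s by rewrite size_rcons size_map size_behead szb prednK.
have iotaS : iota 1 s = 1%N :: iota 2 s.-1 by rewrite -{1}(prednK s0).
(* The indices 1, ..., s are reproduced by dropping 1, lowering the others and appending s, so this
   case is an instance of [cycP]. *)
have iotaR : iota 1 s = rcons [seq l.-1 | l <- iota 2 s.-1] s.
  rewrite -{1}(prednK s0) -[s.-1.+1]addn1 iotaD cats1 add1n prednK //; congr rcons.
  by rewrite (iotaDl 1 1) -map_comp map_id_in.
rewrite szb [in RHS]iotaR [in LHS]iotaS cycP ?size_iota ?szb ?prednK //.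
by apply/allP => l; rewrite mem_iota => /andP[/ltnW].
Qed.
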